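(* For every positive integer $n$ divisible by $4$, there exist an $n$-dimensional acyclic unique sink orientation (AUSO) $\psi$ of the hypercube $Q^n$, a starting vertex $v_0 \in Q^n$, and an ordered list $L$ of the $2n$ directions $\pm[n]$ such that Cunningham's least-recently considered rule with list $L$, started at $v_0$, takes a path of length at least $2^{n/4}$ (i.e. makes at least $2^{n/4}$ steps) before reaching the global sink of $\psi$.
   Context: The $n$-dimensional hypercube $Q^n$ has vertex set $2^{[n]}$ (subsets of $[n]=\{1,\dots,n\}$), with $u,v$ adjacent iff $|u\oplus v|=1$ ($\oplus$ = symmetric difference); the edge between $v$ and $v\oplus\{j\}$ is said to be on coordinate $j$. A face is a set $F(C,v)=\{u : u\oplus v\subseteq C\}$ for $C\subseteq[n]$, $v\in Q^n$. A unique sink orientation (USO) is an orientation of the edges of $Q^n$ such that every nonempty face has exactly one sink (a vertex of the face with no outgoing edge to another vertex of the face); an AUSO is an acyclic USO. The global sink is the unique vertex with no outgoing edges. A direction is a signed coordinate $\pm c$, $c\in[n]$; at vertex $v$, direction $+c$ refers to the edge to $v\cup\{c\}$ (when $c\notin v$) and $-c$ to the edge to $v\setminus\{c\}$ (when $c\in v$). A direction is available at $v$ if the corresponding edge exists and is oriented out of $v$. Cunningham's least-recently considered rule: given an ordered list $L=(L[1],\dots,L[2n])$ of all $2n$ directions, keep a marker $\mu$, initially $\mu=2n$. At each step, at the current vertex (if it is not the global sink), scan the list cyclically starting from $L[\mu+1]$ (continuing from $L[1]$ after $L[2n]$), take the first available direction $L[k]$, move along it, and set $\mu=k$. The walk stops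 at the global sink. *)

(* Defs.v *)
From mathcomp Require Import all_boot.
Set Implicit Arguments. Unset Strict Implicit. Unset Printing Implicit Defensive.

Definition vertex (n : nat) := {set 'I_n}.

Definition symdiff n (A B : vertex n) : vertex n := (A :\: B) :|: (B :\: A).

Definition flip n (v : vertex n) (j : 'I_n) : vertex n := symdiff v [set j].

(* An orientation of Q^n: out v j = true iff the edge between v and
   v (+) {j} is oriented out of v. *)
Definition orientation n := vertex n -> 'I_n -> bool.

Definition is_orientation n (o : orientation n) : Prop :=
  forall v j, o (flip v j) j = ~~ o v j.

Definition face n (C v : vertex n) : {set vertex n} :=
  [set u | symdiff u v \subset C].

Definition face_sink n (o : orientation n) (C v u : vertex n) : bool :=
  (u \in face C v) && [forall j, (flip u j \in face C v) ==> ~~ o u j].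

Definition is_USO n (o : orientation n) : Prop :=
  is_orientation o /\
  forall C v : vertex n, #|[set u | face_sink o C v u]| = 1.

Definition arc n (o : orientation n) (u w : vertex n) : bool :=
  [exists j, (w == flip u j) && o u j].

Definition is_acyclic n (o : orientation n) : Prop :=
  forall (v : vertex n) (p : seq (vertex n)),
    path (arc o) v p -> last v p = v -> p = [::].

Definition is_AUSO n (o : orientation n) : Prop := is_USO o /\ is_acyclic o.

Definition global_sink n (o : orientation n) (v : vertex n) : bool :=
  [forall j, ~~ o v j].

(* Directions: (c, true) = +c, (c, false) = -c. *)
Definition direction n := ('I_n * bool)%type.

Definition available n (o : orientation n) (v : vertex n) (d : direction n) : bool :=
  ((d.1 \in v) != d.2) && o v d.1.

(* Cunningham's least-recently-considered rule.  The list L is indexed from 0,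
   so the marker mu ranges over 0..2n-1 and the paper's initial value 2n
   corresponds to index 2n-1.  One step at state (v, mu): if v is the global
   sink, stay; otherwise scan L cyclically from index mu+1, take the first
   available direction at index k, move along it and set mu := k. *)
Definition cunningham_step n (o : orientation n) (L : seq (direction n))
    (s : vertex n * nat) : vertex n * nat :=
  let: (v, mu) := s in
  if global_sink o v then s else
  let m := size L in
  let idx i := (mu.+1 + i) %% m in
  let i := find (fun i => if onth L (idx i) is Some d then available o v d else false)
                (iota 0 m) in
  let k := idx i in
  match onth L k with
  | Some d => (flip v d.1, k)
  | None => s
  end.

(* Vertex reached after t steps of the rule started at v0 with mu = 2n (index 2n-1). *)
Definition cunningham_vertex n (o : orientation n) (L : seq (direction n))
    (v0 : vertex n) (t : nat) : vertex n :=
  (iter t (cunningham_step o L) (v0, (size L).-1)).1.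

(* Main.v *)
Require Import Defs.
From mathcomp Require Import all_boot.

(* If the list is +1,-1,+2,-2,..., the rule is round robin over coordinates, and
   so commutes with mirroring the cube.  Given a slow AUSO [a] of dimension n, put
   [a] on every n-face of Q^(n+4) but one, which is the face over a common sink z
   of all 4-dimensional fibres and carries the mirror image of [a] whose slow walk
   starts at the sink t of [a].  The fibre at v is one of two frames, according to
   the parity of the round in which the walk in [a] visits v: since each round
   ends at a new v, the frames alternate and keep the last four coordinates away
   from z until the walk rests at t.  Only then does it enter the face over z,
   where the slow walk is run a second time. *)

Set Implicit Arguments. Unset Strict Implicit. Unset Printing Implicit Defensive.

(** * Symmetric differences and flips *)

Section SymmetricDifference.
Variable n : nat.
Implicit Types (A B v d : vertex n) (i j : 'I_n).

Lemma in_symdiff A B i : (i \in symdiff A B) = (i \in A) (+) (i \in B).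
Proof. by rewrite !inE; case: (i \in A); case: (i \in B). Qed.

Lemma in_flip v j i : (i \in flip v j) = (i \in v) (+) (i == j).
Proof. by rewrite in_symdiff inE. Qed.

Lemma symdiffK d : involutive (fun v => symdiff v d).
Proof. by move=> v; apply/setP=> i; rewrite !in_symdiff addbK. Qed.

Lemma symdiff_cancel A B : symdiff A (symdiff A B) = B.
Proof. by apply/setP=> i; rewrite !in_symdiff addKb. Qed.

Lemma flip_symdiff v d j : flip (symdiff v d) j = symdiff (flip v j) d.
Proof. by apply/setP=> i; rewrite !in_symdiff addbAC. Qed.

End SymmetricDifference.

(** * Criteria for unique sinks and for acyclicity *)

Definition separating n (o : orientation n) :=
  forall u v : vertex n, u != v -> exists i, ((i \in u) != (i \in v)) && (o u i != o v i).

Definition ranking n (o : orientation n) (h : vertex n -> nat) :=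
  forall v j, o v j -> h (flip v j) < h v.

Lemma separating_is_orientation n (o : orientation n) :
  separating o -> is_orientation o.
Proof.
move=> sep v j.
have /sep[i]: flip v j != v.
  by apply/eqP=> /setP/(_ j); rewrite in_flip eqxx; case: (j \in v).
rewrite in_flip; have [->|_] := eqVneq i j; last by rewrite addbF eqxx.
by case/andP=> _; case: (o _ _); case: (o _ _).
Qed.

(** The sufficient half of the Szabó-Welzl criterion: on each face the outmap is injective, hence
    bijective by finiteness, so exactly one vertex of the face has an empty outmap. *)
Lemma separating_is_USO n (o : orientation n) : separating o -> is_USO o.
Proof.
move=> sep; split=> [|C v]; first exact: separating_is_orientation.
have sinkP u : reflect (u :\: C = v :\: C /\ forall j, j \in C -> ~~ o u j)
                       (face_sink o C v u).
  have faceE w : (w \in face C v) = (w :\: C == v :\: C).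
    rewrite inE; apply/subsetP/eqP=> [sub | eqC i].
      apply/setP=> i; rewrite !inE; case: (boolP (i \in C)) => //= niC.
      have: i \notin symdiff w v := contra (sub i) niC.
      by rewrite in_symdiff; case: (i \in w); case: (i \in v).
    move/setP/(_ i): eqC; rewrite in_symdiff 2!in_setD.
    by case: (i \in C) => //= ->; rewrite addbb.
  apply: (iffP andP); rewrite faceE.
    case=> /eqP eqC /forallP snk; split=> // j jC.
    apply: (implyP (snk j)); rewrite faceE -eqC; apply/eqP/setP=> i.
    rewrite 2!in_setD in_flip; have [->|_] := eqVneq i j; first by rewrite jC.
    by rewrite addbF.
  case=> eqC snk; split; first by rewrite eqC.
  apply/forallP=> j; apply/implyP; rewrite faceE -eqC => /eqP/setP/(_ j).
  rewrite 2!in_setD in_flip eqxx => eqj; apply: snk.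
  by case: (j \in C) eqj => //=; case: (j \in u).
(* [fill u] is the vertex of the face that agrees with [u] on [C]. [G] keeps the coordinates outside
   [C], which makes it a map of the whole cube to itself, so that injectivity gives a bijection. *)
pose fill u : vertex n := (u :&: C) :|: (v :\: C).
pose G u : vertex n := [set j in C | o (fill u) j] :|: (u :\: C).
have injG : injective G.
  move=> u w eqG; have eqI i := congr1 (fun A : {set 'I_n} => i \in A) eqG.
  have /eqP eqf : fill u == fill w.
    apply/negPn/negP=> /sep[i]; move: (eqI i); rewrite !inE.
    case: (i \in C) => /= [|_]; last by rewrite !andbF eqxx.
    by rewrite !orbF => ->; rewrite eqxx andbF.
  apply/setP=> i; have := congr1 (fun A : {set 'I_n} => i \in A) eqf.
  by move: (eqI i); rewrite !inE; case: (i \in C); rewrite //= ?andbT ?orbF.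
have [Ginv _ GinvK] := injF_bij injG.
have snk u : G u = v :\: C -> face_sink o C v (fill u).
  move=> eqG; apply/sinkP; split=> [|j jC].
    by apply/setP=> i; rewrite !inE; case: (i \in C); rewrite ?andbF.
  by move/setP/(_ j): eqG; rewrite !inE jC /= orbF => ->.
apply/eqP/cards1P; exists (fill (Ginv (v :\: C))); apply/setP=> u; rewrite !inE.
apply/idP/eqP=> [/sinkP[eqC su] | ->]; last exact: snk.
have /sinkP[eqC' sw] := snk _ (GinvK (v :\: C)).
apply/eqP/negPn/negP=> /sep[i].
have := congr1 (fun A : {set 'I_n} => i \in A) (etrans eqC (esym eqC')).
rewrite 2!in_setD; case: (boolP (i \in C)) => /= iC; last by move=> ->; rewrite eqxx.
by move=> _; rewrite (negPf (su i iC)) (negPf (sw i iC)) eqxx andbF.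
Qed.

Lemma ranking_is_acyclic n (o : orientation n) h : ranking o h -> is_acyclic o.
Proof.
move=> rk v p; have: path (Defs.arc o) v p -> h (last v p) + size p <= h v.
  elim: p v => [|w p IHp] v /=; first by rewrite addn0.
  case/andP=> /existsP[j /andP[/eqP-> ovj]] /IHp; rewrite addnS => le_h.
  exact: leq_ltn_trans le_h (rk _ _ ovj).
move=> + pth eq_last; move/(_ pth); rewrite eq_last -[X in _ <= X]addn0 leq_add2l.
by case: p {pth eq_last}.
Qed.

(** * Round-robin sweeps and their move counts *)

(* The second component of a state counts the moves made so far. *)
Definition visit n (o : orientation n) (x : vertex n * nat) (c : 'I_n) :=
  if o x.1 c then (flip x.1 c, x.2.+1) else x.

Definition sweep n (o : orientation n) (s : seq 'I_n) (x : vertex n * nat) :=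
  foldl (visit o) x s.

Definition sweeps n (o : orientation n) s p (x : vertex n * nat) :=
  iter p (sweep o s) x.

Section Sweep.
Variables (n : nat) (o : orientation n).
Implicit Types (x : vertex n * nat) (s : seq 'I_n).

Lemma sweep_cat s1 s2 x : sweep o (s1 ++ s2) x = sweep o s2 (sweep o s1 x).
Proof. exact: foldl_cat. Qed.

Lemma sweepD s x M :
  sweep o s (x.1, x.2 + M) = ((sweep o s x).1, (sweep o s x).2 + M).
Proof.
rewrite /sweep; elim: s x => [|c s IHs] x //=.
by rewrite -IHs /visit /=; case: (o x.1 c).
Qed.

Lemma sweep_rank h s x :
  ranking o h -> h (sweep o s x).1 <= h x.1 ?= iff all (fun c => ~~ o x.1 c) s.
Proof.
move=> rk; rewrite /sweep; elim: s x => [|c s IHs] x /=; first exact: leqif_refl.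
rewrite /visit; have [oxc|noxc] := boolP (o x.1 c); last exact: IHs.
by apply/leqifP=> /=; apply: leq_ltn_trans (rk _ _ oxc); case: (IHs (flip x.1 c, x.2.+1)).
Qed.

Lemma sweep_sink s x : (forall c, ~~ o x.1 c) -> sweep o s x = x.
Proof.
move=> snk; rewrite /sweep; elim: s => //= c s IHs.
by rewrite /visit (negPf (snk c)).
Qed.

End Sweep.

(** * Mirror images *)

Definition mirror n (d : vertex n) (o : orientation n) : orientation n :=
  fun v => o (symdiff v d).

Lemma mirror_separating n d (o : orientation n) : separating o -> separating (mirror d o).
Proof.
move=> sep u v neq_uv.
have /sep[i]: symdiff u d != symdiff v d by rewrite (can_eq (symdiffK d)).
rewrite !in_symdiff => sep_i; exists i.
by move: sep_i; rewrite (can_eq (addbK _)).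
Qed.

Lemma mirror_ranking n d (o : orientation n) h :
  ranking o h -> ranking (mirror d o) (fun v => h (symdiff v d)).
Proof. by move=> rk v j /rk; rewrite flip_symdiff. Qed.

(** A visit asks only whether an edge leaves the vertex, never for its sign, so translating the cube
    by [d] carries walks to walks. *)
Lemma mirror_sweep n d (o : orientation n) s v N :
  sweep (mirror d o) s (symdiff v d, N) =
    (symdiff (sweep o s (v, N)).1 d, (sweep o s (v, N)).2).
Proof.
rewrite /sweep; elim: s v N => //= c s IHs v N.
by rewrite /visit /mirror /= symdiffK; case: (o v c); rewrite /= ?flip_symdiff IHs.
Qed.

(** * Products with a hypersink *)

Section Join.
Variables n k : nat.
Implicit Types (v : vertex n) (u : vertex k).

Definition join v u : vertex (n + k) :=
  [set i | match split i with inl j => j \in v | inr j => j \in u end].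

Lemma in_joinl v u j : (lshift k j \in join v u) = (j \in v).
Proof. by rewrite inE -[lshift _ _]/(unsplit (inl j)) unsplitK. Qed.

Lemma in_joinr v u j : (rshift n j \in join v u) = (j \in u).
Proof. by rewrite inE -[rshift _ _]/(unsplit (inr j)) unsplitK. Qed.

Definition joinE := (in_joinl, in_joinr).

Definition lpart (w : vertex (n + k)) : vertex n := [set j | lshift k j \in w].
Definition rpart (w : vertex (n + k)) : vertex k := [set j | rshift n j \in w].

Lemma joinl v u : lpart (join v u) = v.
Proof. by apply/setP=> j; rewrite inE joinE. Qed.

Lemma joinr v u : rpart (join v u) = u.
Proof. by apply/setP=> j; rewrite inE joinE. Qed.

Lemma join_parts w : join (lpart w) (rpart w) = w.
Proof.
apply/setP=> i; case: (split_ordP i) => j ->; by rewrite joinE inE.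
Qed.

Lemma flip_joinl v u j : flip (join v u) (lshift k j) = join (flip v j) u.
Proof.
apply/setP=> i; case: (split_ordP i) => l ->; rewrite in_flip !joinE ?in_flip.
  by rewrite eq_lshift.
by rewrite eq_rlshift addbF.
Qed.

Lemma flip_joinr v u j : flip (join v u) (rshift n j) = join v (flip u j).
Proof.
apply/setP=> i; case: (split_ordP i) => l ->; rewrite in_flip !joinE ?in_flip.
  by rewrite eq_lrshift addbF.
by rewrite eq_rshift.
Qed.

(* A product over the base [a] with fibres [f v], in which [z] is a sink of every
   fibre; the face over [z] is then a hypersink, and may carry any [b] instead
   of [a]. *)
Variables (a b : orientation n) (f : vertex n -> orientation k) (z : vertex k).

Definition glue : orientation (n + k) := fun w i =>
  match split i with
  | inl j => if rpart w == z then b (lpart w) j else a (lpart w) j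
  | inr j => f (lpart w) (rpart w) j
  end.

Lemma gluel v u j : glue (join v u) (lshift k j) = if u == z then b v j else a v j.
Proof. by rewrite /glue -[lshift _ _]/(unsplit (inl j)) unsplitK joinl joinr. Qed.

Lemma gluer v u j : glue (join v u) (rshift n j) = f v u j.
Proof. by rewrite /glue -[rshift _ _]/(unsplit (inr j)) unsplitK joinl joinr. Qed.

Lemma glue_sweepl s v u N :
  sweep glue (map (lshift k) s) (join v u, N) =
    (join (sweep (if u == z then b else a) s (v, N)).1 u,
     (sweep (if u == z then b else a) s (v, N)).2).
Proof.
rewrite /sweep; elim: s v N => //= c s IHs v N.
by rewrite /visit /= gluel; case: (u == z) IHs => /= IHs; case: ifP => _;
  rewrite ?flip_joinl IHs.
Qed.

Lemma glue_sweepr s v u N :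
  sweep glue (map (@rshift n k) s) (join v u, N) =
    (join v (sweep (f v) s (u, N)).1, (sweep (f v) s (u, N)).2).
Proof.
rewrite /sweep; elim: s u N => //= c s IHs u N.
by rewrite /visit /= gluer; case: ifP => _; rewrite ?flip_joinr IHs.
Qed.

Hypothesis sink_z : forall v j, ~~ f v z j.

Lemma glue_separating :
  separating a -> separating b -> (forall v, separating (f v)) -> separating glue.
Proof.
move=> sa sb sf w w'; rewrite -[w]join_parts -[w']join_parts.
move: (lpart w) (rpart w) (lpart w') (rpart w') => v u v' u' {w w'} neq.
have [eq_u|neq_u] := eqVneq u u'.
  rewrite -eq_u in neq *; have neq_v : v != v' by apply: contraNneq neq => ->.
  have [i] : exists i, ((i \in v) != (i \in v')) &&
      ((if u == z then b v i else a v i) != (if u == z then b v' i else a v' i)).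
    by case: (u == z); [apply: sb | apply: sa].
  by exists (lshift k i); rewrite !joinE !gluel.
have [eq_v|neq_v] := eqVneq v v'.
  rewrite -eq_v in neq *; have [i sep_i] := sf v _ _ neq_u.
  by exists (rshift n i); rewrite !joinE !gluer.
(* The outmap of [z] is empty in every fibre, so a coordinate that separates [z] from another point
   in one fibre still does so across two fibres. *)
have [uz|uz] := eqVneq u z.
  have [i /andP[Hi si]] := sf v' _ _ neq_u; exists (rshift n i).
  rewrite !joinE !gluer Hi; move: si.
  by rewrite uz (negPf (sink_z v' i)) (negPf (sink_z v i)).
have [uz'|uz'] := eqVneq u' z.
  have [i /andP[Hi si]] := sf v _ _ neq_u; exists (rshift n i).
  rewrite !joinE !gluer Hi; move: si.
  by rewrite uz' (negPf (sink_z v' i)) (negPf (sink_z v i)).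
have [i sep_i] := sa _ _ neq_v.
by exists (lshift k i); rewrite !joinE !gluel (negPf uz) (negPf uz').
Qed.

Lemma glue_ranking ha hb hf :
  ranking a ha -> ranking b hb -> (forall v, ranking (f v) (hf v)) ->
  exists h, ranking glue h.
Proof.
move=> ra rb rf.
(* Strict bounds on the ranks of [b] and of the fibres. The rank is lexicographic, base before
   fibre, with the whole face over [z] placed lowest. *)
pose B := (\max_v hb v).+1; pose K := (\max_v \max_u hf v u).+1.
have hb_lt v : hb v < B by rewrite ltnS leq_bigmax.
have hf_lt v u : hf v u < K.
  rewrite ltnS.
  by apply: leq_trans (leq_bigmax u) (leq_bigmax (F := fun v => \max_u hf v u) v).
exists (fun w => if rpart w == z then hb (lpart w)
                 else B + (ha (lpart w) * K + hf (lpart w) (rpart w))).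
move=> w i; rewrite -[w]join_parts; move: (lpart w) (rpart w) => v u {w}.
case: (split_ordP i) => j ->.
  rewrite gluel flip_joinl !joinl !joinr; case: (u == z); first exact: rb.
  move/ra=> lt_h; rewrite ltn_add2l.
  apply: (@leq_trans ((ha (flip v j)).+1 * K)); last first.
    by apply: leq_trans (leq_addr _ _); rewrite leq_mul2r lt_h orbT.
  by rewrite mulSn addnC ltn_add2r.
rewrite gluer flip_joinr !joinl !joinr => fvuj.
have -> : (u == z) = false.
  by apply: contraTF fvuj => /eqP->.
case: eqP => _; first exact: leq_trans (hb_lt v) (leq_addr _ _).
by rewrite !ltn_add2l; apply: rf.
Qed.

End Join.

(** * The two frames of dimension 4 *)

Definition coord4 (i : nat) : 'I_4 := inord i.

Definition bits4 x y z w : vertex 4 := [set i | nth false [:: x; y; z; w] (val i)].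

(* Both frames have the unique sink 1111.  In [frame true], coordinate 1 points to
   1, coordinate 0 copies 1 and 2 copies 0; in [frame false], coordinate 2 points
   to 1 and coordinates 0 and 1 copy 2.  The last coordinate is never moved: it
   only brings the dimension to 4. *)
Definition frame (e : bool) : orientation 4 := fun u i =>
  let x := coord4 0 \in u in let y := coord4 1 \in u in
  let z := coord4 2 \in u in let w := coord4 3 \in u in
  nth false (if e then [:: x (+) y; ~~ y; z (+) x; ~~ w]
             else [:: x (+) z; y (+) z; ~~ z; ~~ w]) (val i).

(** Each term outweighs all those that a move of its coordinate can raise. *)
Definition frame_rank (e : bool) (u : vertex 4) : nat :=
  let x := coord4 0 \in u in let y := coord4 1 \in u in
  let z := coord4 2 \in u in let w := coord4 3 \in u in
  if e then 4 * ~~ y + 2 * (x (+) y) + (z (+) x) + ~~ w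
  else 4 * ~~ z + (x (+) z) + (y (+) z) + ~~ w.

Definition all4 := [seq coord4 i | i <- iota 0 4].

Lemma val_coord4 i : i < 4 -> val (coord4 i) = i.
Proof. exact: inordK. Qed.

Lemma coord4P (P : 'I_4 -> Prop) :
  P (coord4 0) -> P (coord4 1) -> P (coord4 2) -> P (coord4 3) -> forall i, P i.
Proof.
move=> P0 P1 P2 P3 i; rewrite -[i]inord_val -/(coord4 i).
by case: i => [[|[|[|[|i]]]]].
Qed.

Lemma mem_all4 i : i \in all4.
Proof. by rewrite -[i]inord_val map_f // mem_iota ltn_ord. Qed.

Lemma uniq_all4 : uniq all4.
Proof.
rewrite map_inj_in_uniq ?iota_uniq // => i j; rewrite !mem_iota /= => lti ltj.
by move/(congr1 val); rewrite !val_coord4.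
Qed.

Lemma bits4P u : exists x y z w, u = bits4 x y z w.
Proof.
exists (coord4 0 \in u), (coord4 1 \in u), (coord4 2 \in u), (coord4 3 \in u).
by apply/setP; apply: coord4P; rewrite inE val_coord4.
Qed.

Lemma in_bits4 i x y z w :
  i < 4 -> (coord4 i \in bits4 x y z w) = nth false [:: x; y; z; w] i.
Proof. by move=> lti; rewrite inE val_coord4. Qed.

Lemma frame_bits4 e x y z w i : i < 4 ->
  frame e (bits4 x y z w) (coord4 i) =
    nth false (if e then [:: x (+) y; ~~ y; z (+) x; ~~ w]
               else [:: x (+) z; y (+) z; ~~ z; ~~ w]) i.
Proof. by move=> lti; rewrite /frame !in_bits4 // val_coord4. Qed.

Lemma flip_bits4 x y z w :
  [/\ flip (bits4 x y z w) (coord4 0) = bits4 (~~ x) y z w,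
      flip (bits4 x y z w) (coord4 1) = bits4 x (~~ y) z w,
      flip (bits4 x y z w) (coord4 2) = bits4 x y (~~ z) w &
      flip (bits4 x y z w) (coord4 3) = bits4 x y z (~~ w)].
Proof.
by split; apply/setP; apply: coord4P;
  rewrite in_flip !in_bits4 // -val_eqE /= !inordK // ?addbF ?addbT.
Qed.

Definition flip_bits4E x y z w :=
  let: And4 e0 e1 e2 e3 := flip_bits4 x y z w in (e0, e1, e2, e3).

Lemma frame_separating e : separating (frame e).
Proof.
move=> u v neq.
pose sep i := ((i \in u) != (i \in v)) && (frame e u i != frame e v i).
suff /hasP[i _ sep_i] : has sep all4.
  by exists i.
move: neq; rewrite /sep {sep}; have [x [y [z [w ->]]]] := bits4P u; have [x' [y' [z' [w' ->]]]] := bits4P v.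
rewrite /= !in_bits4 // !frame_bits4 //.
by case: e x y z w x' y' z' w' => [] [] [] [] [] [] [] [] []; rewrite /= ?eqxx.
Qed.

Lemma frame_ranking e : ranking (frame e) (frame_rank e).
Proof.
move=> u; have [x [y [z [w ->]]]] := bits4P u.
by apply: coord4P; rewrite frame_bits4 // flip_bits4E /frame_rank !in_bits4 //=;
  case: e x y z w => [] [] [] [] [].
Qed.

Definition sink4 := bits4 true true true true.

Lemma frame_sink e i : ~~ frame e sink4 i.
Proof. by move: i; apply: coord4P; rewrite frame_bits4 //; case: e. Qed.

(** The state after a round of [frame e] while the frames alternate. Coordinate 0 stays at 0, being
    visited before the coordinate that it copies is raised. *)
Definition state4 (e : bool) := bits4 false e (~~ e) true.

Lemma state4_neq_sink e : state4 e != sink4.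
Proof. by apply/eqP=> /setP/(_ (coord4 0)); rewrite !in_bits4. Qed.

(* Alternating the two frames after every round keeps the walk oscillating
   between 0011 and 0101; seeing the same frame twice sends it to the sink. *)
Lemma sweep_state4 e N : sweep (frame e) all4 (state4 (~~ e), N) = (state4 e, N + 2).
Proof.
rewrite addn2 /sweep /= /state4.
by case: e; do 4 rewrite /visit /= frame_bits4 //= ?flip_bits4E /=.
Qed.

Lemma sweep_state4_sink e N : sweep (frame e) all4 (state4 e, N) = (sink4, N + 2).
Proof.
rewrite addn2 /sweep /= /state4.
by case: e; do 4 rewrite /visit /= frame_bits4 //= ?flip_bits4E /=.
Qed.

(** * Doubling the walk with four more dimensions *)

Lemma parity_coloring (T : eqType) (x : nat -> T) p :
  {in [pred i | i <= p] &, injective x} ->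
  exists tau : T -> bool, forall i, i <= p -> tau (x i) = odd i.
Proof.
move=> injx; exists (fun v => odd (index v [seq x i | i <- iota 0 p.+1])) => i le_ip.
congr odd; have lti : i < size [seq x j | j <- iota 0 p.+1] by rewrite size_map size_iota.
have -> : x i = nth (x 0) [seq x j | j <- iota 0 p.+1] i.
  by rewrite (nth_map 0) ?nth_iota -?(size_map x).
rewrite index_uniq // map_inj_in_uniq ?iota_uniq // => j k.
by rewrite !mem_iota !ltnS; apply: injx.
Qed.

(** The induction invariant. The walk must come to rest at a sink, since the next stage starts its
    second run there. *)
Definition slow_sweeps n N := exists (o : orientation n) v s p,
  let y := sweeps o s p (v, 0) in
  [/\ separating o, exists h, ranking o h, uniq s /\ (forall c, c \in s),
      (forall c, ~~ o y.1 c) & N <= y.2].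

Lemma slow_sweeps0 : slow_sweeps 0 0.
Proof.
exists (fun _ _ => false), set0, [::], 0; split=> //; last by split=> // -[].
  by move=> u v /eqP[]; apply/setP=> -[].
by exists (fun _ => 0) => v [].
Qed.

(** The count is two runs of at least [N] moves and the two fibre moves that enter [sink4]; fibre
    moves made during the first run are dropped. *)
Lemma slow_sweeps_step n N : slow_sweeps n N -> slow_sweeps (n + 4) (N.*2 + 2).
Proof.
case=> a [v0 [s [p0 [sep_a [h rk_h] [us fs] snk0 leN0]]]].
pose x i := sweeps a s i (v0, 0).
have xS i : x i.+1 = sweep a s (x i) by [].
pose is_snk i := [forall c, ~~ a (x i).1 c].
have ex_p : exists i, is_snk i by exists p0; apply/forallP.
(* With [p] minimal, every earlier round moves and lowers the rank, so the vertices [(x i).1] for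
   [i <= p] are distinct. *)
have [p /forallP snk_p min_p] := ex_minnP ex_p.
have leN : N <= (x p).2.
  have <- // : x p0 = x p.
  have /subnK<- := min_p _ (introT forallP snk0).
  elim: (p0 - p) => // i IHi; rewrite addSn xS IHi; exact: sweep_sink.
have decr i : i < p -> h (x i.+1).1 < h (x i).1.
  move=> lt_ip; rewrite xS (ltn_leqif (sweep_rank s (x i) rk_h)).
  apply: contraL lt_ip => /allP no_out; rewrite -leqNgt; apply: min_p.
  by apply/forallP=> c; apply: no_out.
have decr_lt i j : i < j <= p -> h (x j).1 < h (x i).1.
  elim: j => // j IHj /andP[]; rewrite ltnS leq_eqVlt => /predU1P[->|lt_ij] lt_jp.
    exact: decr.
  by apply: ltn_trans (decr j lt_jp) (IHj _); rewrite lt_ij ltnW.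
(* A fibre can depend on the vertex but not on time; distinctness makes the parity of the time a
   function of the vertex. *)
have [|tau tauE] := @parity_coloring _ (fun i => (x i).1) p.
  move=> i j; rewrite !inE => le_ip le_jp eq_x; case: (ltngtP i j) => // lt_ij.
    by have := decr_lt i j; rewrite lt_ij le_jp eq_x ltnn => /(_ isT).
  by have := decr_lt j i; rewrite lt_ij le_ip eq_x ltnn => /(_ isT).
(* Translation by [d] exchanges [v0] and [t], so the mirrored walk starts where the first run
   ends. *)
pose t := (x p).1; pose d := symdiff v0 t.
pose o := glue a (mirror d a) (fun v => frame (tau v)) sink4.
pose s' := map (lshift 4) s ++ map (@rshift n 4) all4.
have run1 i : i <= p ->
    exists M, sweeps o s' i (join v0 (state4 false), 0) =
              (join (x i).1 (state4 (odd i)), (x i).2 + M).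
  elim: i => [|i IHi] lt_ip; first by exists 0.
  have [M eqM] := IHi (ltnW lt_ip); exists (M + 2).
  rewrite [sweeps _ _ _ _]iterS -/(sweeps _ _ _ _) eqM sweep_cat.
  (* The base is swept first, so the fibre coordinates already meet the frame over [x i.+1], of
     parity opposite to their state. *)
  rewrite glue_sweepl (negPf (state4_neq_sink _)) sweepD -xS glue_sweepr tauE //.
  have -> : state4 (odd i) = state4 (~~ odd i.+1) by rewrite /= negbK.
  by rewrite sweep_state4; congr (_, _); rewrite addnA.
have run2 K i : sweeps o s' i (join t sink4, K) =
                (join (symdiff (x i).1 d) sink4, (x i).2 + K).
  elim: i => [|i IHi]; first by rewrite /= symdiff_cancel.
  rewrite [sweeps _ _ _ _]iterS -/(sweeps _ _ _ _) IHi sweep_cat.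
  rewrite glue_sweepl eqxx mirror_sweep sweepD -xS glue_sweepr.
  by rewrite sweep_sink // => c; apply: frame_sink.
have [M run_p] := run1 p (leqnn p).
have run_t : sweep o s' (join t (state4 (odd p)), (x p).2 + M) =
             (join t sink4, (x p).2 + M + 2).
  (* The base rests at [t], so the fibre state meets the frame of its own parity and falls into
     [sink4]. *)
  rewrite sweep_cat glue_sweepl (negPf (state4_neq_sink _)) [sweep a _ _]sweep_sink //.
  by rewrite glue_sweepr tauE // sweep_state4_sink.
(* Two runs of [p] rounds, and one round between them to enter the hypersink. *)
exists o, (join v0 (state4 false)), s', (p + p.+1) => y.
have {y}-> : y = (join (symdiff t d) sink4, (x p).2 + ((x p).2 + M + 2)).
  by rewrite /y /sweeps iterD iterS -!/(sweeps _ _ _ _) run_p run_t run2.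
split.
- apply: glue_separating => // [v c|| v].
  + exact: frame_sink.
  + exact: mirror_separating.
  + exact: frame_separating.
- have rk_f v : ranking (frame (tau v)) (frame_rank (tau v)) by apply: frame_ranking.
  have rk_m := mirror_ranking (d := d) rk_h.
  exact: (glue_ranking (f := fun v => frame (tau v)) (fun v => @frame_sink _)
    rk_h rk_m rk_f).
- split=> [|c]; last first.
    rewrite mem_cat; case: (split_ordP c) => j ->; apply/orP; [left|right].
      exact: map_f.
    by rewrite map_f ?mem_all4.
  rewrite cat_uniq (map_inj_uniq (@lshift_inj _ _)) (map_inj_uniq (@rshift_inj _ _)).
  rewrite us uniq_all4 andbT; apply/hasPn=> _ /mapP[j _ ->]; apply/mapP=> -[l _ /eqP].
  by rewrite eq_rlshift.
- move=> c; case: (split_ordP c) => j ->.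
    by rewrite /o /= gluel eqxx /mirror symdiffK.
  by rewrite /o /= gluer; apply: frame_sink.
rewrite /= -addnn !addnA leq_add2r; apply: leq_trans (leq_addr _ _); exact: leq_add.
Qed.

(** The bound solves the recurrence sending [N] to [2N + 2], started at 0. *)
Lemma slow_sweeps_mul4 m : slow_sweeps (m * 4) (2 ^ m.+1 - 2).
Proof.
elim: m => [|m /slow_sweeps_step]; first exact: slow_sweeps0.
have le2 : 2 <= 2 ^ m.+1 by rewrite (leq_exp2l 1).
rewrite mulSnr [2 ^ m.+2]expnS mul2n doubleB -[2.*2]/(2 + 2) subnDA subnK //.
by rewrite leq_subRL -addnn ?leq_add // ltn_addr.
Qed.

(** * From sweeps to Cunningham's rule *)

Section Cunningham.
Variables (n : nat) (o : orientation n) (L : seq (direction n)).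
Variables (d0 : direction n) (v0 : vertex n).
Local Notation m := (size L).
Local Notation dir i := (nth d0 L (i %% m)).

Definition consider (x : vertex n * nat) (d : direction n) :=
  if available o x.1 d then (flip x.1 d.1, x.2.+1) else x.

(** The rule slowed down to one list entry per time unit, whether or not it yields a move. *)
Fixpoint trace i := if i is j.+1 then consider (trace j) (dir j) else (v0, 0).

Hypothesis m_gt0 : 0 < m.

Lemma cunningham_step_first v mu i :
    i < m -> available o v (dir (mu.+1 + i)) ->
    (forall j, j < i -> ~~ available o v (dir (mu.+1 + j))) ->
  cunningham_step o L (v, mu) = (flip v (dir (mu.+1 + i)).1, (mu.+1 + i) %% m).
Proof.
move=> lt_im av_i min_i; rewrite /cunningham_step ifN; last first.
  by apply/forallPn; exists (dir (mu.+1 + i)).1; case/andP: av_i => _; rewrite negbK.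
set a := (fun j => _); have onthE j : onth L (j %% m) = Some (dir j).
  by rewrite onthE (nth_map d0) ?ltn_pmod.
have aE j : a j = available o v (dir (mu.+1 + j)) by rewrite /a onthE.
suff -> : find a (iota 0 m) = i by rewrite onthE.
have has_a : has a (iota 0 m) by apply/hasP; exists i; rewrite ?mem_iota ?aE.
have lt_find : find a (iota 0 m) < m by rewrite -[X in _ < X](size_iota 0) -has_find.
apply/eqP; rewrite eqn_leq leqNgt [X in _ && X]leqNgt; apply/andP; split.
  by apply/negP=> /(before_find 0); rewrite nth_iota // aE av_i.
apply/negP=> /min_i; have := nth_find 0 has_a; rewrite nth_iota //.
by rewrite aE => ->.
Qed.

Lemma trace_still i j :
    (forall k, k < j -> ~~ available o (trace i).1 (dir (i + k))) ->
  trace (i + j) = trace i.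
Proof.
elim: j => [|j IHj] no_av; first by rewrite addn0.
rewrite addnS /= IHj => [|k lt_kj]; last by apply: no_av; apply: leqW.
by rewrite /consider (negPf (no_av j _)).
Qed.

(** Here [i] is 0 or the time just after the [t]-th move. The marker is [i - 1] modulo [m], written
    with [m.-1] so that [i = 0] gives the initial marker. *)
Lemma cunningham_trace t T : t <= (trace T).2 ->
  exists i, [/\ i <= T, (trace i).2 = t &
    iter t (cunningham_step o L) (v0, m.-1) = ((trace i).1, (i + m.-1) %% m)].
Proof.
elim: t => [_|t IHt lt_tT].
  by exists 0; rewrite modn_small // prednK.
have [i [le_iT eq_t eq_state]] := IHt (ltnW lt_tT).
pose av k := available o (trace i).1 (dir (i + k)).
have /hasP[k0 + av_k0]: has av (iota 0 (T - i)).
  apply: contraLR lt_tT => /hasPn no_av; rewrite -leqNgt -eq_t.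
  rewrite -[in T in trace T](subnKC le_iT) trace_still // => k lt_k.
  by apply: no_av; rewrite mem_iota.
rewrite mem_iota add0n => /= lt_k0.
have [k av_k min_k] := ex_minnP (ex_intro av k0 av_k0).
(* Availability at a fixed vertex is periodic in [k], so the least [k] is at most its own
   residue. *)
have lt_km : k < m.
  apply: leq_ltn_trans (ltn_pmod k m_gt0); apply: min_k.
  by rewrite /av modnDmr.
have still : trace (i + k) = trace i.
  by apply: trace_still => j lt_jk; apply: contraL lt_jk => /min_k; rewrite -leqNgt.
exists (i + k).+1; rewrite /= still /consider [available _ _ _]av_k /= eq_t; split=> //.
  by rewrite -addnS -leq_subRL // (leq_ltn_trans (min_k _ av_k0)).
have modE j : ((i + m.-1) %% m).+1 + j = i + j %[mod m].
  by rewrite addSnnS modnDml -addnA [m.-1 + _]addnC addSnnS prednK // addnA modnDr.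
rewrite eq_state (@cunningham_step_first _ _ k) ?modE //; last first.
  by move=> j lt_jk; rewrite modE; apply: contraL lt_jk => /min_k; rewrite -leqNgt.
by rewrite addSnnS prednK // modnDr.
Qed.

(** At a sink the trace is frozen, so its counter could not exceed [t] later. *)
Lemma cunningham_not_sink t T :
  t < (trace T).2 -> ~~ global_sink o (cunningham_vertex o L v0 t).
Proof.
move=> lt_tT; have [i [le_iT eq_t eq_state]] := cunningham_trace (ltnW lt_tT).
rewrite /cunningham_vertex eq_state /=; apply: contraL lt_tT => /forallP snk.
rewrite -leqNgt -eq_t -[in T in trace T](subnKC le_iT) trace_still // => k _.
by rewrite /available negb_and snk orbT.
Qed.

Lemma trace_round i : trace (i.+1 * m) = foldl consider (trace (i * m)) L.
Proof.
suff trE j : j <= m -> trace (i * m + j) = foldl consider (trace (i * m)) (take j L).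
  by rewrite mulSnr trE // take_size.
elim: j => [|j IHj] lt_jm; first by rewrite addn0 take0.
by rewrite addnS /= IHj 1?ltnW // (take_nth d0) // foldl_rcons modnMDl modn_small.
Qed.

End Cunningham.

(* With +c and -c adjacent in the list, the rule becomes round robin over
   coordinates: right after a move along +c, -c points back and is unavailable. *)
Lemma consider_pair n (o : orientation n) x c :
  is_orientation o -> consider o (consider o x (c, true)) (c, false) = visit o x c.
Proof.
move=> oP; rewrite /consider /visit /available /=.
have [xc|xc] := boolP (c \in x.1) => /=; first by rewrite xc; case: (o x.1 c).
by case oxc: (o x.1 c); rewrite /= ?(negPf xc) // oP oxc andbF.
Qed.

Theorem theorem3 (n : nat) :
  0 < n -> 4 %| n ->
  exists (psi : orientation n) (v0 : vertex n) (L : seq (direction n)),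
    [/\ is_AUSO psi,
        uniq L, (forall d : direction n, d \in L) &
        forall t, t < 2 ^ (n %/ 4) -> ~~ global_sink psi (cunningham_vertex psi L v0 t)].
Proof.
move=> n_gt0 /dvdnP[m def_n]; have m_gt0 : 0 < m by case: m def_n n_gt0 => [->|].
have := slow_sweeps_mul4 m; rewrite -def_n.
case=> psi [v0 [s [p [sep [h rk_h] [us fs] _ leN]]]].
pose L : seq (direction n) := [seq (c, b) | c <- s, b <- [:: true; false]].
have fL d : d \in L by case: d => c b; apply: allpairs_f; rewrite ?fs //; case: b.
exists psi, v0, L; split=> //.
- by split; [apply: separating_is_USO | apply: ranking_is_acyclic rk_h].
- by apply: allpairs_uniq => // -[c b] [c' b'].
have L_gt0 : 0 < size L by have /(_ (Ordinal n_gt0, true)) := fL; case: (L).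
move=> t; have -> : n %/ 4 = m by rewrite def_n mulnK.
move=> lt_t.
apply: (@cunningham_not_sink _ _ _ (Ordinal n_gt0, true) _ L_gt0 _ (p * size L)).
have -> : trace psi L (Ordinal n_gt0, true) v0 (p * size L) = sweeps psi s p (v0, 0).
  elim: (p) => [|i IHi] //; rewrite trace_round IHi [RHS]iterS -/(sweeps _ _ _ _).
  move: (sweeps _ _ _ _) => x; rewrite /L /sweep.
  elim: (s) x => //= c s' IHs x; rewrite consider_pair; first exact: IHs.
  exact: separating_is_orientation.
(* As [m] is positive, [2 ^ m] is at least 2 and hence at most [2 ^ m.+1 - 2]. *)
apply: leq_trans lt_t (leq_trans _ leN).
by rewrite expnS mul2n -addnn -addnBA ?leq_addr // (leq_exp2l 1).
Qed.
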